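(* Let $q$ be a prime power, $r\ge4$, and let $S\subseteq\mathrm{PG}(r,q)$ be an even set of size $q^{r-1}+2q^{r-2}$. Assume that there exists at least one plane meeting $S$ in exactly $q+2$ points and that for every such plane $\pi$ and every $3$-dimensional subspace $\Sigma\supseteq\pi$, the set $S\cap\Sigma$ is a hypercylinder in $\Sigma$. Then $S$ is a hypercylinder in $\mathrm{PG}(r,q)$.
   Context: A set $S$ of points of $\mathrm{PG}(r,q)$ is an even set if every line meets $S$ in an even number of points. A hyperoval of a projective plane $\mathrm{PG}(2,q)$ is a set of $q+2$ points no three collinear. A hypercylinder in $\mathrm{PG}(m,q)$ ($m\ge3$) is obtained as follows: take an $(m-3)$-dimensional subspace $\pi$, a plane $\sigma$ disjoint from $\pi$, and a hyperoval $\mathcal{H}\subseteq\sigma$; the hypercylinder is $\left(\bigcup_{P\in\mathcal{H}}\langle P,\pi\rangle\right)\setminus\pi$ (for $m=3$, $\pi$ is a point). *)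

(* Defs.v *)
From HB Require Import structures.
From mathcomp Require Import all_boot all_order all_algebra.

Set Implicit Arguments.
Unset Strict Implicit.
Unset Printing Implicit Defensive.

(* The subType structure of {vspace _} is only available from this module. *)
Section FiniteVspace.
Import VectorInternalTheory.
Variables (F : finFieldType) (vT : vectType F).
HB.instance Definition _ := [Countable of {vspace vT} by <:].
HB.instance Definition _ := [Finite of {vspace vT} by <:].
End FiniteVspace.

(* PG(r, F) is the lattice of subspaces of F^(r+1), so a subspace of projective
   dimension k is a vector subspace of dimension k + 1. *)
Notation pgspace F r := {vspace 'rV[F]_(r.+1)}.

Section ProjectiveSpace.

Variables (F : finFieldType) (r : nat).
Implicit Types U W L : pgspace F r.

Definition has_pdim (k : nat) U : bool := \dim U == k.+1.

Record pgpoint := PGPoint {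
  pgpoint_val :> pgspace F r;
  pgpoint_pdim : has_pdim 0 pgpoint_val
}.

HB.instance Definition _ := [isSub for pgpoint_val].
HB.instance Definition _ := [Finite of pgpoint by <:].

Implicit Types (P Q : pgpoint) (S H : {set pgpoint}).

Definition pgpoints U : {set pgpoint} := [set P : pgpoint | (P <= U)%VS].

Definition even_set S : Prop :=
  forall L, has_pdim 1 L -> ~~ odd #|S :&: pgpoints L|.

Definition collinear P1 P2 P3 : Prop :=
  exists L, has_pdim 1 L /\ [/\ (P1 <= L)%VS, (P2 <= L)%VS & (P3 <= L)%VS].

Definition hyperoval (sigma : pgspace F r) H : Prop :=
  [/\ has_pdim 2 sigma, H \subset pgpoints sigma, #|H| = #|F| + 2 &
      forall P1 P2 P3, P1 \in H -> P2 \in H -> P3 \in H ->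
        P1 != P2 -> P1 != P3 -> P2 != P3 -> ~ collinear P1 P2 P3].

(* S is a hypercylinder in the m-dimensional projective space W. *)
Definition hypercylinder (m : nat) W S : Prop :=
  [/\ 3 <= m, has_pdim m W &
  exists (pi sigma : pgspace F r) (H : {set pgpoint}),
    [/\ (pi <= W)%VS, has_pdim (m - 3) pi, (sigma <= W)%VS,
        (sigma :&: pi)%VS = 0%VS & hyperoval sigma H] /\
    S = (\bigcup_(P in H) pgpoints (P + pi)%VS) :\: pgpoints pi].

End ProjectiveSpace.

(* Main.v *)
Require Import Defs.
From HB Require Import structures.
From mathcomp Require Import all_boot all_order all_algebra.
From mathcomp Require Import zify.

Set Implicit Arguments.
Unset Strict Implicit.
Unset Printing Implicit Defensive.

Import GRing.Theory.

(* Work with the vectors spanning points of S. The vectors whose translations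
   preserve this set, its periods, form a subspace R, and S is a cone over R, so
   it suffices that R and a hyperoval plane sigma span the whole space. The
   vertex v of a cylindrical solid W is a period: if x is outside W, then in the
   4-space <W, x> every solid missing v has q^2 + 2q points of S, out of
   q^3 + 2q^2. Counting along pencils, the property "every hyperplane missing v
   contains a fraction 1/q of S" passes to all subspaces through v, down to the
   line <x, v>, where it says that translation by v preserves S. For q > 2 the
   vertex of a cylindrical solid through sigma is never in sigma, because q does
   not divide q + 2. For q = 2 evenness alone says that S is the complement of a
   hyperplane, which is then R. *)

Local Notation npoints S U := #|S :&: pgpoints U|.

Lemma card_finNzRing_gt0 (R : finNzRingType) : 0 < #|R|.
Proof. exact: ltnW (card_finNzRing_gt1 R). Qed.

Lemma card_finNzRing_pred_gt0 (R : finNzRingType) : 0 < #|R|.-1.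
Proof. by rewrite -subn1 subn_gt0 card_finNzRing_gt1. Qed.

Section AddLine.

Variables (K : fieldType) (vT : vectType K).
Implicit Types (U W H : {vspace vT}) (v w : vT).

Lemma vlineZ (a : K) v : a != 0%R -> <[a *: v]>%VS = <[v]>%VS.
Proof.
move=> a0; apply/eqP; rewrite eqEsubv -!memvE memvZ ?memv_line //=.
by rewrite -{1}(scalerK a0 v) memvZ ?memv_line.
Qed.

Lemma memv_add_line U v : v \in (U + <[v]>)%VS.
Proof. by rewrite (subvP (addvSr _ _)) ?memv_line. Qed.

Lemma notin_vspace_neq0 U v : v \notin U -> v != 0%R.
Proof. by apply: contraNneq => ->; apply: mem0v. Qed.

Lemma directv_add_line U v : v \notin U -> directv (U + <[v]>).
Proof.
move=> vU; apply/directv_addP/eqP; rewrite -subv0; apply/subvP => x.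
case/memv_capP=> Ux /vlineP[k xE]; rewrite memv0 xE.
apply: contraNT vU; rewrite scaler_eq0 negb_or => /andP[k0 _].
by rewrite -(scalerK k0 v) -xE memvZ.
Qed.

Lemma dim_add_line U v : v \notin U -> \dim (U + <[v]>) = (\dim U).+1.
Proof.
move=> vU; have /directv_addP cap0 := directv_add_line vU.
by rewrite dimv_disjoint_sum // dim_vline (notin_vspace_neq0 vU) addn1.
Qed.

Lemma add_line_exchange U v w : w \in (U + <[v]>)%VS -> w \notin U ->
  (U + <[w]>)%VS = (U + <[v]>)%VS.
Proof.
move=> wUv wU; have vU : v \notin U.
  apply: contraNN wU => vU; suff <- : (U + <[v]>)%VS = U by [].
  by apply/addv_idPl; rewrite -memvE.
by apply/eqP; rewrite eqEdim subv_add addvSl -memvE wUv !dim_add_line /=.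
Qed.

Lemma notin_add_line U v w : v \notin U -> w \notin (U + <[v]>)%VS ->
  v \notin (U + <[w]>)%VS.
Proof.
move=> vU; apply: contraNN => vUw.
by rewrite (add_line_exchange vUw vU) memv_add_line.
Qed.

Lemma notin_add_scale U v w a : w \notin (U + <[v]>)%VS ->
  (w + a *: v)%R \notin U.
Proof.
apply: contraNN => wavU; rewrite -(addrK (a *: v)%R w) -scaleNr.
by rewrite memv_add ?memvZ ?memv_line.
Qed.

Lemma add_line_shift U v w : v \in U -> (U + <[w + v]>)%VS = (U + <[w]>)%VS.
Proof.
move=> Uv; apply/eqP; rewrite eqEsubv !subv_add !addvSl -!memvE /=.
rewrite [(w + v)%R]addrC memv_add ?memv_line //=.
by rewrite -{1}(addKr v w) memv_add ?rpredN ?memv_line.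
Qed.

Definition hyperplane_off v U H := v \notin H /\ (H + <[v]>)%VS = U.

Lemma hyperplane_off_sub v U H : hyperplane_off v U H -> (H <= U)%VS.
Proof. by case=> _ <-; apply: addvSl. Qed.

Lemma hyperplane_off_mem v U H : hyperplane_off v U H -> v \in U.
Proof. by case=> _ <-; apply: memv_add_line. Qed.

Lemma dim_hyperplane_off v U H : hyperplane_off v U H -> \dim U = (\dim H).+1.
Proof. by case=> vH <-; apply: dim_add_line. Qed.

Lemma hyperplane_off_cap v U W H : v \in W -> (W <= U)%VS ->
  hyperplane_off v U H -> hyperplane_off v W (H :&: W).
Proof.
move=> vW WU [vH HU]; split; first by apply: contraNN vH => /memv_capP[].
by rewrite capvC vspace_modr -?memvE // HU; apply/capv_idPl.
Qed.

Lemma hyperplane_off_add_line v U H w : hyperplane_off v U H -> w \notin U ->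
  hyperplane_off v (U + <[w]>) (H + <[w]>).
Proof.
case=> vH HU wU; split; first by rewrite notin_add_line // HU.
by rewrite -addvA [(<[w]> + _)%VS]addvC addvA HU.
Qed.

Lemma hyperplane_off_diff v U : v != 0%R -> v \in U ->
  hyperplane_off v U (U :\: <[v]>).
Proof.
move=> v0 vU; split; last by rewrite addv_diff; apply/addv_idPl; rewrite -memvE.
apply: contraNN v0 => vD; rewrite -memv0 -(capv_diff U <[v]>).
by apply/memv_capP; rewrite memv_line.
Qed.

End AddLine.

Section SubspaceSums.

Variables (F : finFieldType) (n : nat).
Local Notation V := 'rV[F]_n.
Implicit Types (U T : {vspace V}) (v w : V).

Section BigOp.

Variables (R : Type) (idx : R) (op : Monoid.com_law idx).
Implicit Types f : V -> R.

Lemma big_addv f U T : directv (U + T) ->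
  \big[op/idx]_(x in (U + T)%VS) f x =
  \big[op/idx]_(x in U) \big[op/idx]_(y in T) f (x + y)%R.
Proof.
move=> /directv_add_unique decomp; rewrite pair_big /=.
pose A := [pred p : V * V | (p.1 \in U) && (p.2 \in T)].
have addI : {in A &, injective (fun p : V * V => p.1 + p.2)%R}.
  move=> [x y] [x' y'] /andP[/= Ux Ty] /andP[/= Ux' Ty'] /eqP.
  by rewrite decomp // => /eqP.
rewrite -(big_imset _ addI); apply: eq_bigl => x.
apply/memv_addP/imsetP => [[u Uu [t Tt ->]]|[[u t] /andP[Uu Tt] ->]].
  by exists (u, t); rewrite // inE /= Uu.
by exists u => //; exists t.
Qed.

Lemma big_vline f v : v != 0%R ->
  \big[op/idx]_(x in <[v]>%VS) f x = \big[op/idx]_(a : F) f (a *: v)%R.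
Proof.
move=> v0; have scaleI : injective (fun a : F => a *: v)%R.
  move=> a b /eqP; rewrite -subr_eq0 -scalerBl scaler_eq0 (negbTE v0) orbF.
  by rewrite subr_eq0 => /eqP.
rewrite -[RHS](big_imset (h := fun a => (a *: v)%R) (A := F) f (in2W scaleI)).
apply: eq_bigl => x; apply/vlineP/imsetP => [[a ->]|[a _ ->]]; last by exists a.
by exists a.
Qed.

Lemma big_add_line f U v : v \notin U ->
  \big[op/idx]_(x in (U + <[v]>)%VS) f x =
  \big[op/idx]_(a : F) \big[op/idx]_(x in U) f (x + a *: v)%R.
Proof.
move=> vU; rewrite big_addv ?directv_add_line // exchange_big /=.
pose g y := \big[op/idx]_(x in U) f (x + y)%R.
exact: (big_vline g (notin_vspace_neq0 vU)).
Qed.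

Lemma big_add_lineD0 f U v : v \notin U ->
  \big[op/idx]_(x in (U + <[v]>)%VS) f x =
  op (\big[op/idx]_(x in U) f x)
     (\big[op/idx]_(a | a != 0%R) \big[op/idx]_(x in U) f (x + a *: v)%R).
Proof.
move=> vU; rewrite big_add_line // (bigD1 0%R) //=.
by under eq_bigr do rewrite scale0r addr0.
Qed.

End BigOp.

(* The vectors of [U + <v> + <w>] outside [U] are partitioned by the subspaces
   [U + <v>] and [U + <w + c v>]. *)
Lemma sum_pencil (f : V -> nat) U v w :
  v \notin U -> w \notin (U + <[v]>)%VS ->
  \sum_(x in (U + <[v]> + <[w]>)%VS) f x + #|F| * \sum_(x in U) f x =
  \sum_(x in (U + <[v]>)%VS) f x +
  \sum_(c : F) \sum_(x in (U + <[w + c *: v]>)%VS) f x.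
Proof.
move=> vU wUv; have wcU c : (w + c *: v)%R \notin U by apply: notin_add_scale.
under [X in _ = _ + X]eq_bigr do rewrite big_add_lineD0 //.
rewrite big_split sum_nat_const big_add_lineD0 //= -addnA; congr (_ + _).
rewrite addnC; congr (_ + _); rewrite [RHS]exchange_big /=.
apply: eq_bigr => b b0; rewrite big_add_line // (reindex_inj (mulfI b0)) /=.
apply: eq_bigr => c _; apply: eq_bigr => x _.
by rewrite scalerDr scalerA -addrA [(b *: w + _)%R]addrC.
Qed.

End SubspaceSums.

Section VectorsOfPoints.

Variables (F : finFieldType) (r : nat).
Local Notation V := 'rV[F]_(r.+1).
Implicit Types (S H : {set pgpoint F r}) (P Q : pgpoint F r).
Implicit Types (U : pgspace F r) (v w x : V).

Lemma pgpoint_line P : exists2 x, x != 0%R & pgpoint_val P = <[x]>%VS.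
Proof.
have dimP := eqP (pgpoint_pdim P).
have P0 : vpick P != 0%R by rewrite vpick0 -dimv_eq0 dimP.
exists (vpick P) => //; apply/eqP; rewrite eq_sym eqEdim dim_vline P0 dimP.
by rewrite -memvE memv_pick.
Qed.

Lemma line_pgpoint x : x != 0%R -> exists P, pgpoint_val P = <[x]>%VS.
Proof.
move=> x0; have dimx : has_pdim 0 <[x]>%VS by rewrite /has_pdim dim_vline x0.
by exists (PGPoint dimx).
Qed.

Lemma mem_pgpoints U P x : pgpoint_val P = <[x]>%VS ->
  (P \in pgpoints U) = (x \in U).
Proof. by move=> Px; rewrite inE Px memvE. Qed.

Definition vec_in S x := [exists P in S, pgpoint_val P == <[x]>%VS].

Lemma vec_inP S x :
  reflect (exists2 P, P \in S & pgpoint_val P = <[x]>%VS) (vec_in S x).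
Proof.
by apply: (iffP exists_inP) => -[P PS /eqP Px]; exists P => //; apply/eqP.
Qed.

Lemma vec_in_pgpoint S P x : pgpoint_val P = <[x]>%VS -> vec_in S x = (P \in S).
Proof.
move=> Px; apply/vec_inP/idP => [[Q QS Qx]|PS]; last by exists P.
by have -> : P = Q by apply: val_inj; rewrite /= Px Qx.
Qed.

Lemma vec_in0 S : vec_in S 0%R = false.
Proof.
apply/vec_inP => -[P _ P0]; have := pgpoint_pdim P.
by rewrite P0 /has_pdim dim_vline eqxx.
Qed.

Lemma vec_inZ S (a : F) x : a != 0%R -> vec_in S (a *: x)%R = vec_in S x.
Proof. by move=> a0; rewrite /vec_in vlineZ. Qed.

Lemma vec_in_inj S H : vec_in S =1 vec_in H -> S = H.
Proof.
move=> eqSH; apply/setP => P; have [x _ Px] := pgpoint_line P.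
by rewrite -!(vec_in_pgpoint _ Px).
Qed.

Lemma vec_in_cap S U x : vec_in (S :&: pgpoints U) x = vec_in S x && (x \in U).
Proof.
have [->|x0] := eqVneq x 0%R; first by rewrite !vec_in0.
have [P Px] := line_pgpoint x0.
by rewrite !(vec_in_pgpoint _ Px) inE (mem_pgpoints _ Px).
Qed.

Lemma vec_in_sum S x :
  (vec_in S x : nat) = \sum_(P in S) (pgpoint_val P == <[x]>%VS).
Proof.
case: vec_inP => [[P PS Px]|noP]; last first.
  by rewrite big1 // => P PS; case: eqP => // Px; case: noP; exists P.
rewrite (bigD1 P) //= Px eqxx big1 // => Q /andP[_ QP].
by rewrite -Px val_eqE (negbTE QP).
Qed.

Lemma sum_pgpoint P : \sum_(x : V) (pgpoint_val P == <[x]>%VS) = #|F|.-1.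
Proof.
have [p p0 ->] := pgpoint_line P.
transitivity (\sum_(x in <[p]>%VS) (<[p]>%VS == <[x]>%VS)).
  rewrite [RHS]big_mkcond; apply: eq_bigr => x _.
  by case: eqP => [->|_]; rewrite ?memv_line ?if_same.
rewrite big_vline // -(cardC1 (0%R : F)) -sum1_card [RHS]big_mkcond.
apply: eq_bigr => a _; rewrite inE; have [->|a0] := eqVneq a 0%R.
  by rewrite scale0r; case: eqP => // E; rewrite -memv0 -E memv_line in p0.
by rewrite vlineZ ?eqxx.
Qed.

Lemma sum_vec_in S U : \sum_(x in U) vec_in S x = #|F|.-1 * npoints S U.
Proof.
transitivity (\sum_x (vec_in (S :&: pgpoints U) x : nat)).
  rewrite big_mkcond; apply: eq_bigr => x _; rewrite vec_in_cap andbC.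
  by case: ifP.
under eq_bigr do rewrite vec_in_sum.
rewrite exchange_big /=; under eq_bigr do rewrite sum_pgpoint.
by rewrite sum_nat_const mulnC.
Qed.

Lemma npoints_vline S x : x != 0%R -> npoints S <[x]>%VS = vec_in S x.
Proof.
move=> x0; rewrite vec_in_sum -sum1_card big_mkcond [RHS]big_mkcond.
apply: eq_bigr => P _; rewrite !inE; case: (P \in S) => //=.
by rewrite eqEdim dim_vline x0 (eqP (pgpoint_pdim P)) andbT; case: ifP.
Qed.

Lemma npoints0 S : npoints S 0%VS = 0.
Proof.
apply/eqP; rewrite -(eqn_pmul2l (card_finNzRing_pred_gt0 F)) -sum_vec_in.
by rewrite big1 ?muln0 // => x; rewrite memv0 => /eqP ->; rewrite vec_in0.
Qed.

Lemma npoints_pencil S U v w : v \notin U -> w \notin (U + <[v]>)%VS ->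
  npoints S (U + <[v]> + <[w]>)%VS + #|F| * npoints S U =
  npoints S (U + <[v]>)%VS +
  \sum_(c : F) npoints S (U + <[w + c *: v]>)%VS.
Proof.
move=> vU wUv; apply/eqP.
rewrite -(eqn_pmul2l (card_finNzRing_pred_gt0 F)); apply/eqP.
rewrite !mulnDr big_distrr /= mulnCA -!sum_vec_in.
under [X in _ = _ + X]eq_bigr do rewrite -sum_vec_in.
exact: sum_pencil.
Qed.

Lemma npoints_line S v w : v != 0%R -> w \notin <[v]>%VS ->
  npoints S (<[v]> + <[w]>)%VS =
  vec_in S v + \sum_(c : F) vec_in S (w + c *: v)%R.
Proof.
move=> v0 wv; have v0' : v \notin 0%VS by rewrite memv0.
have := npoints_pencil S v0'; rewrite add0v => /(_ w wv).
rewrite npoints0 muln0 addn0 => ->; rewrite npoints_vline //.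
congr (_ + _); apply: eq_bigr => c _; rewrite add0v npoints_vline //.
by rewrite -memv0 notin_add_scale // add0v.
Qed.

Lemma hyperoval_vec_in S U : hyperoval U (S :&: pgpoints U) ->
  exists2 s, s \in U & vec_in S s.
Proof.
case=> _ _ cardU _.
have /card_gt0P[P] : 0 < npoints S U by rewrite cardU addn2.
have [s _ Ps] := pgpoint_line P.
by rewrite -(vec_in_pgpoint _ Ps) vec_in_cap => /andP[sS sU]; exists s.
Qed.

End VectorsOfPoints.

Section Periods.

Variables (F : finFieldType) (r : nat).
Local Notation V := 'rV[F]_(r.+1).
Implicit Types (S H : {set pgpoint F r}).
Implicit Types (W T pi sigma : pgspace F r) (v s p : V).

Definition periodic S pi W :=
  {in W & pi, forall x v, vec_in S (x + v)%R = vec_in S x}.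

Lemma npoints_periodic S v W T : hyperplane_off v W T ->
  periodic S <[v]>%VS W -> npoints S W = #|F| * npoints S T.
Proof.
move=> off per; apply/eqP.
rewrite -(eqn_pmul2l (card_finNzRing_pred_gt0 F)) mulnCA.
rewrite -!sum_vec_in; have [vT <-] := off; rewrite big_add_line //.
rewrite -sum_nat_const; apply/eqP.
apply: eq_bigr => a _; apply: eq_bigr => x Tx.
by rewrite per ?memvZ ?memv_line // (subvP (hyperplane_off_sub off)).
Qed.

Definition punctured_cone pi H :=
  (\bigcup_(P in H) pgpoints (P + pi)%VS) :\: pgpoints pi.

Lemma vec_in_punctured_cone pi sigma H s p : (sigma :&: pi)%VS = 0%VS ->
  H \subset pgpoints sigma -> s \in sigma -> p \in pi ->
  vec_in (punctured_cone pi H) (s + p)%R = vec_in H s.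
Proof.
move=> sigma_pi Hsigma ss pp.
have cap0 x : x \in sigma -> x \in pi -> x = 0%R.
  by move=> xs xpi; apply/eqP; rewrite -memv0 -sigma_pi; apply/memv_capP.
have [s0|s0] := eqVneq s 0%R.
  rewrite s0 add0r vec_in0; apply/vec_inP => -[P].
  rewrite inE => /andP[Ppi _] Pp.
  by rewrite (mem_pgpoints _ Pp) pp in Ppi.
have sp_pi : (s + p)%R \notin pi.
  by rewrite rpredDr //; apply: contraNN s0 => spi; rewrite (cap0 s).
have sp0 : (s + p)%R != 0%R by apply: contraNneq sp_pi => ->; rewrite mem0v.
have [P Psp] := line_pgpoint sp0.
rewrite (vec_in_pgpoint _ Psp) inE (mem_pgpoints _ Psp) sp_pi /=.
apply/bigcupP/vec_inP => -[Q QH]; rewrite ?(mem_pgpoints _ Psp) => Qs.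
  have [y y0 Qy] := pgpoint_line Q; exists Q => //.
  have ys : y \in sigma by rewrite -(mem_pgpoints _ Qy) (subsetP Hsigma).
  move: Qs; rewrite Qy => /memv_addP[_ /vlineP[k ->] [z zpi spE]].
  move/directv_addP/directv_add_unique: sigma_pi => decomp.
  move/eqP: spE; rewrite decomp ?memvZ // => /eqP[sky _].
  by rewrite sky vlineZ //; apply: contraNneq s0 => k0; rewrite sky k0 scale0r.
by exists Q; rewrite // (mem_pgpoints _ Psp) Qs memv_add ?memv_line.
Qed.

Lemma hypercylinder_periodic m S W : hypercylinder m W (S :&: pgpoints W) ->
  exists pi sigma, [/\ (sigma :&: pi)%VS = 0%VS, (sigma + pi)%VS = W,
    periodic S pi W & hyperoval sigma (S :&: pgpoints sigma)].
Proof.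
move=> [m3 /eqP dimW [pi [sigma [H [[piW /eqP dimpi sigmaW cap0 hH] SE]]]]].
have [/eqP dimsigma Hsigma _ _] := hH.
have WE : (sigma + pi)%VS = W.
  apply/eqP; rewrite eqEdim subv_add sigmaW piW dimv_disjoint_sum //=.
  by rewrite dimW dimsigma dimpi; lia.
have vec_inW s p : s \in sigma -> p \in pi -> vec_in S (s + p)%R = vec_in H s.
  move=> ss pp; rewrite -(vec_in_punctured_cone cap0 Hsigma ss pp).
  by rewrite /punctured_cone -SE vec_in_cap -WE memv_add // andbT.
exists pi, sigma; split=> //.
  move=> x v; rewrite -WE => /memv_addP[s ss [p pp ->]] vpi.
  by rewrite -addrA !vec_inW ?memvD.
suff -> : S :&: pgpoints sigma = H by [].
apply: vec_in_inj => x; rewrite vec_in_cap andbC.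
have [xs|xs] /= := boolP (x \in sigma).
  by rewrite -[x]addr0 vec_inW ?mem0v ?addr0.
apply/esym; apply: contraNF xs => /vec_inP[P PH Px].
by rewrite -(mem_pgpoints _ Px) (subsetP Hsigma).
Qed.

Lemma periodic_punctured_cone S pi sigma W :
  (sigma :&: pi)%VS = 0%VS -> (sigma + pi)%VS = W -> periodic S pi W ->
  S :&: pgpoints W = punctured_cone pi (S :&: pgpoints sigma).
Proof.
move=> cap0 WE per; apply: vec_in_inj => x; rewrite vec_in_cap.
have [xW|xW] := boolP (x \in W); rewrite ?andbT ?andbF.
  move: (xW); rewrite -WE => /memv_addP[s ss [p pp ->]].
  rewrite (vec_in_punctured_cone cap0) ?subsetIr // vec_in_cap ss andbT per //.
  by rewrite -WE (subvP (addvSl _ _)).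
apply/esym; apply: contraNF xW => /vec_inP[P]; rewrite inE => /andP[_].
case/bigcupP=> Q; rewrite inE => /andP[_ Qsigma] PQ Px.
rewrite -(mem_pgpoints _ Px); move: Qsigma PQ; rewrite !inE => Qsigma.
by move=> /subv_trans -> //; rewrite -WE addvS.
Qed.

Lemma periodic_hypercylinder m S W pi sigma : 3 <= m -> has_pdim m W ->
  (sigma :&: pi)%VS = 0%VS -> (sigma + pi)%VS = W -> periodic S pi W ->
  hyperoval sigma (S :&: pgpoints sigma) ->
  hypercylinder m W (S :&: pgpoints W).
Proof.
move=> m3 dimW cap0 WE per hsigma; split=> //.
exists pi, sigma, (S :&: pgpoints sigma).
split; last exact: periodic_punctured_cone.
have [/eqP dimsigma _ _ _] := hsigma; split; rewrite // -?WE ?addvSl ?addvSr //.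
have := dimv_disjoint_sum cap0; rewrite WE dimsigma (eqP dimW) /has_pdim.
by move=> dimE; apply/eqP; lia.
Qed.

Definition periods S : pgspace F r :=
  (\sum_(v | [forall x, vec_in S (x + v)%R == vec_in S x]) <[v]>)%VS.

Lemma periodsP S v :
  reflect (forall x, vec_in S (x + v)%R = vec_in S x) (v \in periods S).
Proof.
apply: (iffP idP) => [/memv_sumP[u u_line ->] | per]; last first.
  rewrite memvE; apply: (sumv_sup v) => //.
  by apply/forallP => x; rewrite per.
elim/big_rec: _ => [|w z w_per z_per] x; first by rewrite addr0.
have /vlineP[a ->] := u_line w w_per; rewrite addrA z_per.
have [->|a0] := eqVneq a 0%R; first by rewrite scale0r addr0.
rewrite -[in LHS](scalerKV a0 x) -scalerDr vec_inZ //.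
by rewrite (eqP (forallP w_per _)) vec_inZ ?invr_eq0.
Qed.

Lemma hypercylinder_periods S sigma : 3 <= r ->
  hyperoval sigma (S :&: pgpoints sigma) ->
  (sigma + periods S)%VS = fullv -> hypercylinder r fullv S.
Proof.
move=> r3 hS full; have pgpointsT : S :&: pgpoints fullv = S.
  by apply/setIidPl/subsetP => P _; rewrite inE subvf.
rewrite -pgpointsT.
apply: (@periodic_hypercylinder _ _ _ (periods S :\: sigma) sigma) => //.
- by rewrite /has_pdim dimvf /dim /= mul1n.
- by rewrite capvC capv_diff.
- by rewrite addvC addv_diff addvC.
by move=> x v _ /(subvP (diffvSl _ _)) /periodsP.
Qed.

End Periods.

Section Balanced.

Variables (F : finFieldType) (r : nat).
Local Notation V := 'rV[F]_(r.+1).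
Implicit Types (S : {set pgpoint F r}) (U T : pgspace F r) (v w x : V).

(* The averaged form of invariance under translation by [v]. Unlike invariance
   itself, it can be checked by counting, and it passes to subspaces. *)
Definition balanced S v U :=
  forall T, hyperplane_off v U T -> npoints S U = #|F| * npoints S T.

Lemma balanced_drop_line S v U w : v \in U -> w \notin U ->
  balanced S v (U + <[w]>)%VS -> balanced S v U.
Proof.
move=> vU wU bal T off; have [vT TU] := off.
have wT : w \notin (T + <[v]>)%VS by rewrite TU.
have pencil_member c :
    npoints S (U + <[w]>)%VS = #|F| * npoints S (T + <[w + c *: v]>)%VS.
  have cvU : (c *: v)%R \in U by rewrite memvZ.
  apply: bal; rewrite -(add_line_shift w cvU).
  by apply: hyperplane_off_add_line; rewrite // rpredDr.
have /(congr1 (muln #|F|)) := npoints_pencil S vT wT.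
rewrite TU !mulnDr [X in _ = _ + X]big_distrr /=.
rewrite -(eq_bigr _ (fun c _ => pencil_member c)) sum_nat_const addnC.
by move=> /addIn/eqP; rewrite (eqn_pmul2l (card_finNzRing_gt0 F)) => /eqP.
Qed.

Lemma balanced_sub S v U T : v \in T -> (T <= U)%VS ->
  balanced S v U -> balanced S v T.
Proof.
have [m] := ubnP (\dim U - \dim T); elim: m T => // m IH T dimUT vT TU bal.
have [UT|/subvPn[w Uw wT]] := boolP (U <= T)%VS.
  by have -> : T = U by apply/eqP; rewrite eqEsubv TU.
have TwU : (T + <[w]> <= U)%VS by rewrite subv_add TU -memvE.
apply: (@balanced_drop_line _ _ _ w) => //; apply: IH => //; last first.
  exact: (subvP (addvSl _ _)).
by have := dimvS TwU; rewrite dim_add_line // => ?; lia.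
Qed.

Lemma balanced_line S v x : v != 0%R -> x \notin <[v]>%VS ->
  balanced S v (<[v]> + <[x]>)%VS -> vec_in S (x + v)%R = vec_in S x.
Proof.
move=> v0 xv bal; have npoints_through w : w \notin <[v]>%VS ->
    (<[v]> + <[w]>)%VS = (<[v]> + <[x]>)%VS ->
    npoints S (<[v]> + <[x]>)%VS = #|F| * vec_in S w.
  move=> wv wE; rewrite -npoints_vline ?(notin_vspace_neq0 wv) //.
  apply: bal; split; last by rewrite addvC.
  by rewrite -[<[w]>%VS]add0v notin_add_line ?memv0 // add0v.
have := npoints_through x xv erefl.
rewrite (npoints_through (x + v)%R) ?rpredDr ?memv_line //; last first.
  by rewrite add_line_shift // memv_line.
move/eqP; rewrite (eqn_pmul2l (card_finNzRing_gt0 F)).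
by case: (vec_in S x); case: (vec_in S (x + v)%R).
Qed.

End Balanced.

Section CylindricalSolids.

Variables (F : finFieldType) (r : nat).
Local Notation V := 'rV[F]_(r.+1).
Implicit Types (S : {set pgpoint F r}) (U W T : pgspace F r) (v w : V).

Definition oval_sized_plane S U :=
  has_pdim 2 U && (npoints S U == #|F| + 2).

Lemma hyperoval_oval_sized S U :
  hyperoval U (S :&: pgpoints U) -> oval_sized_plane S U.
Proof. by case=> dimU _ cardU _; rewrite /oval_sized_plane dimU cardU eqxx. Qed.

Lemma pdim_add_line k U v : has_pdim k U -> v \notin U ->
  has_pdim k.+1 (U + <[v]>)%VS.
Proof. by rewrite /has_pdim => /eqP dimU vU; rewrite dim_add_line // dimU. Qed.

Lemma hypercylinder3_vertex S W : hypercylinder 3 W (S :&: pgpoints W) ->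
  exists v T, [/\ hyperplane_off v W T, periodic S <[v]>%VS W &
    hyperoval T (S :&: pgpoints T)].
Proof.
move=> hW; have [_ /eqP dimW _] := hW.
have [pi [T [cap0 TW per hT]]] := hypercylinder_periodic hW.
have [/eqP dimT _ _ _] := hT.
have dimpi : has_pdim 0 pi.
  have := dimv_disjoint_sum cap0; rewrite TW dimT dimW /has_pdim.
  by move=> dimE; apply/eqP; lia.
have [v v0 /= piE] := pgpoint_line (PGPoint dimpi).
rewrite piE in cap0 TW per; exists v, T; split=> //; split=> //.
apply: contraNN v0 => vT; rewrite -memv0 -cap0.
by apply/memv_capP; rewrite memv_line.
Qed.

Definition cylindrical S := forall U W, oval_sized_plane S U -> has_pdim 3 W ->
  (U <= W)%VS -> hypercylinder 3 W (S :&: pgpoints W).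

Lemma npoints_cylindrical_solid S U W : cylindrical S ->
  oval_sized_plane S U -> has_pdim 3 W -> (U <= W)%VS ->
  npoints S W = #|F| * (#|F| + 2).
Proof.
move=> cylS ovU dimW UW.
have [v [T [off per [_ _ cardT _]]]] :=
  hypercylinder3_vertex (cylS _ _ ovU dimW UW).
by rewrite (npoints_periodic off per) cardT.
Qed.

Lemma npoints_cylindrical_4space S U v w : cylindrical S ->
  oval_sized_plane S U -> v \notin U -> w \notin (U + <[v]>)%VS ->
  npoints S (U + <[v]> + <[w]>)%VS = #|F| * (#|F| * (#|F| + 2)).
Proof.
move=> cylS ovU vU wUv; have [dimU /eqP cardU] := andP ovU.
have solid z : z \notin U -> npoints S (U + <[z]>)%VS = #|F| * (#|F| + 2).
  move=> zU; apply: (npoints_cylindrical_solid cylS ovU) (addvSl _ _).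
  exact: pdim_add_line.
have := npoints_pencil S vU wUv; rewrite cardU solid //.
under eq_bigr => c _.
  rewrite solid ?notin_add_scale //.
  over.
by rewrite sum_nat_const addnC => /addnI.
Qed.

Lemma exists_hyperoval_plane S U : 3 <= r -> cylindrical S ->
  oval_sized_plane S U -> exists T, hyperoval T (S :&: pgpoints T).
Proof.
move=> r3 cylS ovU; have [dimU _] := andP ovU.
have /subvPn[y _ yU] : ~~ (fullv <= U)%VS.
  by apply/negP => /dimvS; rewrite (eqP dimU) dimvf /dim /=; lia.
have [v [T [_ _ hT]]] := hypercylinder3_vertex
  (cylS _ _ ovU (pdim_add_line dimU yU) (addvSl _ _)).
by exists T.
Qed.

Lemma periodic_oval_sized S v W U T : hyperplane_off v W U ->
  periodic S <[v]>%VS W -> oval_sized_plane S U -> hyperplane_off v W T ->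
  oval_sized_plane S T.
Proof.
move=> offU per /andP[dimU cardU] offT; rewrite /oval_sized_plane /has_pdim.
have := dim_hyperplane_off offT; rewrite (dim_hyperplane_off offU) => -[<-].
rewrite -/(has_pdim 2 U) dimU -(eqP cardU) /=.
rewrite -(eqn_pmul2l (card_finNzRing_gt0 F)).
by rewrite -(npoints_periodic offU per) -(npoints_periodic offT per).
Qed.

(* A solid of the 4-space missing the vertex [v] meets [W] in a plane missing
   [v], so it is again a cylinder. *)
Lemma vertex_balanced S v W U w : cylindrical S -> hyperplane_off v W U ->
  periodic S <[v]>%VS W -> oval_sized_plane S U -> w \notin W ->
  balanced S v (W + <[w]>)%VS.
Proof.
move=> cylS offU per ovU wW T offT; have [vU UW] := offU.
have [dimU _] := andP ovU.
rewrite -{1}UW npoints_cylindrical_4space ?UW //; congr (_ * _); apply/esym.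
apply: (@npoints_cylindrical_solid _ (T :&: W)%VS) => //; last exact: capvSl.
  apply: (periodic_oval_sized offU) => //.
  exact: hyperplane_off_cap (hyperplane_off_mem offU) (addvSl _ _) offT.
have := dim_hyperplane_off offT.
by rewrite dim_add_line // (dim_hyperplane_off offU) (eqP dimU) => -[/esym/eqP].
Qed.

Lemma vertex_period S v W U : cylindrical S -> hyperplane_off v W U ->
  periodic S <[v]>%VS W -> oval_sized_plane S U -> v \in periods S.
Proof.
move=> cylS offU per ovU; apply/periodsP => x.
have vW := hyperplane_off_mem offU.
have [xW|xW] := boolP (x \in W); first by rewrite per ?memv_line.
have v0 : v != 0%R by apply: notin_vspace_neq0 offU.1.
have vsubW : (<[v]> <= W)%VS by rewrite -memvE.
apply: balanced_line => //; first by apply: contraNN xW; apply: subvP.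
apply: balanced_sub (vertex_balanced cylS offU per ovU xW).
  by rewrite (subvP (addvSl _ _)) ?memv_line.
exact: addvS.
Qed.

Lemma vertex_notin_oval_sized S U W v : 2 < #|F| -> oval_sized_plane S U ->
  (U <= W)%VS -> v != 0%R -> periodic S <[v]>%VS W -> v \notin U.
Proof.
move=> F_gt2 /andP[_ /eqP cardU] UW v0 per; apply/negP => vU.
have perU : periodic S <[v]>%VS U.
  by move=> x w xU wv; rewrite per // (subvP UW).
have := npoints_periodic (hyperplane_off_diff v0 vU) perU; rewrite cardU.
by move/(congr1 (modn^~ #|F|)); rewrite modnMr modnDl modn_small.
Qed.

Lemma cylindrical_add_periods S U : 2 < #|F| -> cylindrical S ->
  oval_sized_plane S U -> (U + periods S)%VS = fullv.
Proof.
move=> F_gt2 cylS ovU; apply/eqP; rewrite eqEsubv subvf; apply/subvP => y _.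
have [yU|yU] := boolP (y \in U); first exact: (subvP (addvSl _ _)).
have [dimU _] := andP ovU.
have [v [T [off per /hyperoval_oval_sized ovT]]] :=
  hypercylinder3_vertex (cylS _ _ ovU (pdim_add_line dimU yU) (addvSl _ _)).
have v0 : v != 0%R by apply: notin_vspace_neq0 off.1.
have vU := vertex_notin_oval_sized F_gt2 ovU (addvSl _ _) v0 per.
have v_per := vertex_period cylS off per ovT.
have /subvP sub : (U + <[v]> <= U + periods S)%VS by rewrite addvS // -memvE.
apply: sub; rewrite (add_line_exchange (hyperplane_off_mem off) vU).
exact: memv_add_line.
Qed.

End CylindricalSolids.

Section EvenSetsOrder2.

Variables (F : finFieldType) (r : nat).
Local Notation V := 'rV[F]_(r.+1).
Implicit Types (S : {set pgpoint F r}) (U : pgspace F r) (x z s : V).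

Lemma even_set2_vec_inD S x z : #|F| = 2 -> even_set S -> z != 0%R ->
  x \notin <[z]>%VS -> vec_in S (x + z)%R = vec_in S x (+) vec_in S z.
Proof.
move=> F2 evS z0 xz.
have dimL : has_pdim 1 (<[z]> + <[x]>)%VS.
  by apply: pdim_add_line; rewrite // /has_pdim dim_vline z0.
have setF : [set: F] = [set 0%R; 1%R].
  by apply/esym/eqP; rewrite eqEcard subsetT cardsT F2 cards2 eq_sym oner_eq0.
have neq0E (a : F) : (a != 0%R) = (a == 1%R).
  have : a \in [set: F] by rewrite inE.
  by rewrite setF => /set2P[] ->; rewrite eqxx ?oner_eq0 // eq_sym oner_eq0.
have := evS _ dimL; rewrite npoints_line // (bigD1 0%R) //= (big_pred1 1%R) //.
rewrite scale0r addr0 scale1r.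
by case: (vec_in S x); case: (vec_in S z); case: (vec_in S (x + z)%R).
Qed.

Lemma notin_even_set2_period S z : #|F| = 2 -> even_set S -> ~~ vec_in S z ->
  z \in periods S.
Proof.
move=> F2 evS zS; apply/periodsP => x.
have [->|z0] := eqVneq z 0%R; first by rewrite addr0.
have [/vlineP[a ->]|xz] := boolP (x \in <[z]>%VS); last first.
  by rewrite even_set2_vec_inD // (negbTE zS) addbF.
have multiple_notin b : vec_in S (b *: z)%R = false.
  have [->|b0] := eqVneq b 0%R; first by rewrite scale0r vec_in0.
  by rewrite vec_inZ // (negbTE zS).
by rewrite -[X in (_ + X)%R]scale1r -scalerDl !multiple_notin.
Qed.

Lemma even_set2_add_periods S U s : #|F| = 2 -> even_set S ->
  s \in U -> vec_in S s -> (U + periods S)%VS = fullv.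
Proof.
move=> F2 evS sU sS; apply/eqP; rewrite eqEsubv subvf; apply/subvP => y _.
have s0 : s != 0%R by apply: contraTneq sS => ->; rewrite vec_in0.
have [ys|ys] := boolP (y \in <[s]>%VS).
  by apply: (subvP (addvSl _ _)); apply: subvP ys; rewrite -memvE.
have [yS|yS] := boolP (vec_in S y); last first.
  by apply: (subvP (addvSr _ _)); apply: notin_even_set2_period.
rewrite -(addKr s y) memv_add ?rpredN // addrC.
by apply: notin_even_set2_period; rewrite // even_set2_vec_inD // yS sS.
Qed.

End EvenSetsOrder2.

Theorem theorem5p6 (F : finFieldType) (q r : nat) (hq : #|F| = q) (hr : 4 <= r)
  (S : {set pgpoint F r})
  (hS : even_set S)
  (hcard : #|S| = q ^ (r - 1) + 2 * q ^ (r - 2))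
  (hex : exists pi : pgspace F r,
      has_pdim 2 pi /\ #|S :&: pgpoints pi| = q + 2)
  (hcyl : forall pi Sigma : pgspace F r,
      has_pdim 2 pi -> #|S :&: pgpoints pi| = q + 2 ->
      has_pdim 3 Sigma -> (pi <= Sigma)%VS ->
      hypercylinder 3 Sigma (S :&: pgpoints Sigma)) :
  hypercylinder r fullv S.
Proof.
subst q; have r3 := ltnW hr.
have cylS : cylindrical S.
  by move=> U W /andP[dimU /eqP cardU]; apply: hcyl.
have [pi [dimpi /eqP cardpi]] := hex.
have ovpi : oval_sized_plane S pi by apply/andP.
have [sigma hsigma] := exists_hyperoval_plane r3 cylS ovpi.
apply: (hypercylinder_periods r3 hsigma).
have [F2|F2] := eqVneq #|F| 2.
  have [s] := hyperoval_vec_in hsigma.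
  exact: even_set2_add_periods.
apply: cylindrical_add_periods (hyperoval_oval_sized hsigma) => //.
by rewrite ltn_neqAle eq_sym F2; apply: card_finNzRing_gt1.
Qed.
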